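(* The class $\mathcal{M}$ is closed under multiplication: if $m_1, m_2\in\mathcal{M}$, then the pointwise product $m_1m_2$ belongs to $\mathcal{M}$.
   Context: $\mathcal{M}$ denotes the set of functions $m\in C^2[0,1]$ such that: (C1) $m(s)>0$ for $s>0$ and $m(0)=0$; (C2) $m'(s)>0$ for $s>0$ and $m'(0)=0$; (C3) $m''(s)>0$ for $s>0$; (C4) the function $\frac{m''}{m'}$ is decreasing on $(0,1)$. ''Decreasing'' means strictly decreasing. *)

(* Defs.v *)
From Stdlib Require Export Reals.
Open Scope R_scope.

Definition unit_interval (s : R) : Prop := 0 <= s <= 1.

(* [d] is the derivative on [D] of [f], all difference quotients being taken
   inside [D]: at the end points of an interval it is the one-sided one. *)
Definition derivative_on (D : R -> Prop) (f d : R -> R) : Prop :=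
  forall s, D s -> D_in f d D s.

Definition continuous_on (D : R -> Prop) (f : R -> R) : Prop :=
  forall s, D s -> continue_in f D s.

Definition strictly_decreasing_on (D : R -> Prop) (f : R -> R) : Prop :=
  forall s t, D s -> D t -> s < t -> f t < f s.

(* [m] is in C^2[0,1], with first and second derivatives [m'] and [m''] there.
   Only the values on [0,1] matter; they determine [m'] and [m''] on [0,1].
   Continuity of [m] and [m'] follows from differentiability. *)
Definition C2_01 (m m' m'' : R -> R) : Prop :=
  derivative_on unit_interval m m' /\
  derivative_on unit_interval m' m'' /\
  continuous_on unit_interval m''.

Definition class_M (m : R -> R) : Prop :=
  exists m' m'' : R -> R,
    C2_01 m m' m'' /\
    ((forall s, 0 < s <= 1 -> 0 < m s) /\ m 0 = 0) /\
    ((forall s, 0 < s <= 1 -> 0 < m' s) /\ m' 0 = 0) /\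
    (forall s, 0 < s <= 1 -> 0 < m'' s) /\
    strictly_decreasing_on (fun s => 0 < s < 1) (fun s => m'' s / m' s).

(* Main.v *)
Require Import Defs.
From Stdlib Require Import Reals Lra.
From Coquelicot Require Import Rcomplements.
Open Scope R_scope.

(** For [m] in the class, the monotone form of l'Hôpital's rule, applied to
    [m' / m] at [0], turns (C4) into two facts: [m' / m] decreases as well, and
    it dominates [m'' / m'].  For the product of two members with quotients
    [p = m1'' / m1'], [a = m1' / m1], [q = m2'' / m2'], [b = m2' / m2], the
    quotient of (C4) is [(p a + q b + 2 a b) / (a + b)].  It increases in [p]
    and [q]; it increases in [a] because [p - q + 2 b > 0] and in [b] because
    [q - p + 2 a > 0].  All four arguments decrease, so the quotient does. *)

Definition closed_interval (a b x : R) : Prop := a <= x <= b.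

Definition open_interval (a b x : R) : Prop := a < x < b.

Lemma closed_interval_included (a b s t : R) :
  a <= s -> t <= b -> included (closed_interval s t) (closed_interval a b).
Proof. intros has htb x hx; unfold closed_interval in *; lra. Qed.

Lemma open_interval_included (a b s t : R) :
  a <= s -> t <= b -> included (open_interval s t) (open_interval a b).
Proof. intros has htb x hx; unfold open_interval in *; lra. Qed.

Lemma open_interval_included_closed (a b : R) :
  included (open_interval a b) (closed_interval a b).
Proof. intros x hx; unfold open_interval, closed_interval in *; lra. Qed.

Lemma derivative_on_included (D E : R -> Prop) (f f' : R -> R) :
  included E D -> derivative_on D f f' -> derivative_on E f f'.
Proof. intros sub df s hs; apply (D_in_imp _ _ D); [exact sub | auto]. Qed.

Lemma derivative_on_continuous (D : R -> Prop) (f f' : R -> R) :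
  derivative_on D f f' -> continuous_on D f.
Proof. intros df s hs; exact (cont_deriv _ _ _ _ (df s hs)). Qed.

Lemma derivative_on_plus (D : R -> Prop) (f f' g g' : R -> R) :
  derivative_on D f f' -> derivative_on D g g' ->
  derivative_on D (fun s => f s + g s) (fun s => f' s + g' s).
Proof. intros df dg s hs; apply Dadd; auto. Qed.

Lemma derivative_on_mult (D : R -> Prop) (f f' g g' : R -> R) :
  derivative_on D f f' -> derivative_on D g g' ->
  derivative_on D (fun s => f s * g s) (fun s => f' s * g s + f s * g' s).
Proof. intros df dg s hs; apply Dmult; auto. Qed.

Lemma continuous_on_plus (D : R -> Prop) (f g : R -> R) :
  continuous_on D f -> continuous_on D g -> continuous_on D (fun s => f s + g s).
Proof. intros cf cg s hs; apply limit_plus; [apply cf | apply cg]; exact hs. Qed.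

Lemma continuous_on_mult (D : R -> Prop) (f g : R -> R) :
  continuous_on D f -> continuous_on D g -> continuous_on D (fun s => f s * g s).
Proof. intros cf cg s hs; apply limit_mul; [apply cf | apply cg]; exact hs. Qed.

Lemma C2_01_mult (f f' f'' g g' g'' : R -> R) :
  C2_01 f f' f'' -> C2_01 g g' g'' ->
  C2_01 (fun s => f s * g s)
    (fun s => f' s * g s + f s * g' s)
    (fun s => (f'' s * g s + f' s * g' s) + (f' s * g' s + f s * g'' s)).
Proof.
  intros (df & df' & cf'') (dg & dg' & cg'').
  pose proof (derivative_on_continuous _ _ _ df).
  pose proof (derivative_on_continuous _ _ _ df').
  pose proof (derivative_on_continuous _ _ _ dg).
  pose proof (derivative_on_continuous _ _ _ dg').
  split; [|split].
  - apply derivative_on_mult; assumption.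
  - apply derivative_on_plus; apply derivative_on_mult; assumption.
  - repeat apply continuous_on_plus; apply continuous_on_mult; assumption.
Qed.

Lemma strictly_decreasing_on_ext (D : R -> Prop) (f g : R -> R) :
  (forall s, D s -> f s = g s) ->
  strictly_decreasing_on D f -> strictly_decreasing_on D g.
Proof.
  intros eq_fg f_decr s t hs ht hst.
  rewrite <- !eq_fg by assumption; apply f_decr; assumption.
Qed.

Lemma D_in_open_interval (D : R -> Prop) (f f' : R -> R) (a b x : R) :
  included (open_interval a b) D -> open_interval a b x -> D_in f f' D x ->
  derivable_pt_lim f x (f' x).
Proof.
  intros sub [hax hxb] df.
  apply derivable_pt_lim_D_in; intros eps eps_pos.
  destruct (df eps eps_pos) as [del [del_pos hdel]].
  exists (Rmin del (Rmin (x - a) (b - x))); split.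
  - repeat apply Rmin_pos; lra.
  - intros y [[_ x_neq_y] hy]; simpl in hy; unfold Rdist in hy.
    apply Rmin_Rgt_l in hy as [hy_del hy].
    apply Rmin_Rgt_l in hy as [hy_a hy_b].
    apply Rabs_def2 in hy_a, hy_b.
    apply hdel; split; [split; [apply sub; split; lra | exact x_neq_y] | exact hy_del].
Qed.

(** The mean value theorem of the library asks for two-sided continuity at the
    end points; precomposing with the projection onto the interval supplies it
    without changing the values on the interval. *)
Definition clamp (a b x : R) : R := Rmax a (Rmin b x).

Lemma clamp_in (a b x : R) : a <= b -> closed_interval a b (clamp a b x).
Proof.
  unfold clamp, closed_interval, Rmax, Rmin.
  destruct (Rle_dec b x), (Rle_dec a _); lra.
Qed.

Lemma clamp_id (a b x : R) : closed_interval a b x -> clamp a b x = x.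
Proof.
  unfold clamp, closed_interval, Rmax, Rmin.
  destruct (Rle_dec b x), (Rle_dec a _); lra.
Qed.

Lemma clamp_contract (a b x y : R) :
  Rabs (clamp a b x - clamp a b y) <= Rabs (x - y).
Proof.
  unfold clamp, Rmax, Rmin, Rabs.
  destruct (Rle_dec b x), (Rle_dec b y); repeat destruct (Rle_dec a _);
    repeat destruct (Rcase_abs _); lra.
Qed.

Lemma continuity_clamp (f : R -> R) (a b : R) :
  a <= b -> continuous_on (closed_interval a b) f ->
  continuity (fun x => f (clamp a b x)).
Proof.
  intros hab cf x eps eps_pos.
  destruct (cf _ (clamp_in a b x hab) eps eps_pos) as [del [del_pos hdel]].
  exists del; split; [exact del_pos|].
  intros y [_ hy]; simpl in *; unfold Rdist in *.
  destruct (Req_dec (clamp a b x) (clamp a b y)) as [eq_xy | neq_xy].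
  - rewrite eq_xy, Rminus_diag, Rabs_R0; exact eps_pos.
  - apply hdel; split; [split; [apply clamp_in; exact hab | exact neq_xy]|].
    pose proof (clamp_contract a b y x); lra.
Qed.

Lemma derivable_pt_lim_clamp (f f' : R -> R) (a b x : R) :
  derivative_on (closed_interval a b) f f' -> open_interval a b x ->
  derivable_pt_lim (fun y => f (clamp a b y)) x (f' x).
Proof.
  intros df hx.
  pose proof (open_interval_included_closed a b) as sub.
  apply (derivable_pt_lim_locally_ext f _ x a b); [exact hx | |].
  - intros y hy; rewrite clamp_id by exact (sub y hy); reflexivity.
  - exact (D_in_open_interval _ f f' a b x sub hx (df x (sub x hx))).
Qed.

Lemma derivative_on_Cauchy_MVT (D : R -> Prop) (f f' g g' : R -> R) (a b : R) :
  derivative_on D f f' -> derivative_on D g g' ->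
  a < b -> included (closed_interval a b) D ->
  exists c, open_interval a b c /\ (f b - f a) * g' c = (g b - g a) * f' c.
Proof.
  intros df dg hab sub.
  apply (derivative_on_included _ _ _ _ sub) in df, dg.
  assert (clamp_derivable : forall h h', derivative_on (closed_interval a b) h h' ->
    forall c, a < c < b -> derivable_pt (fun x => h (clamp a b x)) c).
  { intros h h' dh c hc; exists (h' c); apply derivable_pt_lim_clamp; assumption. }
  destruct (MVT _ _ a b (clamp_derivable f f' df) (clamp_derivable g g' dg) hab)
    as (c & hc & mean_value).
  - intros c _; apply continuity_clamp; [lra | exact (derivative_on_continuous _ _ _ df)].
  - intros c _; apply continuity_clamp; [lra | exact (derivative_on_continuous _ _ _ dg)].
  - exists c; split; [exact hc|].
    rewrite (derive_pt_eq_0 _ _ (f' c)), (derive_pt_eq_0 _ _ (g' c)) in mean_value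
      by (apply derivable_pt_lim_clamp; assumption).
    rewrite !clamp_id in mean_value by (unfold closed_interval; lra).
    symmetry; exact mean_value.
Qed.

Lemma derivative_on_pos_lt (D : R -> Prop) (f f' : R -> R) (a b : R) :
  derivative_on D f f' -> a < b -> included (closed_interval a b) D ->
  (forall c, open_interval a b c -> 0 < f' c) -> f a < f b.
Proof.
  intros df hab sub f'_pos.
  destruct (derivative_on_Cauchy_MVT D f f' (fun x => x) (fun _ => 1) a b)
    as (c & hc & mean_value); try assumption.
  - intros x _; apply Dx.
  - assert (0 < (b - a) * f' c) by (apply Rmult_lt_0_compat; [lra | auto]).
    lra.
Qed.

Section MonotoneLHopital.

Variables (a b : R) (f f' g g' : R -> R).
Hypothesis df : derivative_on (closed_interval a b) f f'.
Hypothesis dg : derivative_on (closed_interval a b) g g'.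
Hypothesis fa0 : f a = 0.
Hypothesis ga0 : g a = 0.
Hypothesis g'_pos : forall s, open_interval a b s -> 0 < g' s.
Hypothesis ratio'_decr :
  strictly_decreasing_on (open_interval a b) (fun s => f' s / g' s).

Lemma denominator_lt (s t : R) : a <= s -> s < t -> t <= b -> g s < g t.
Proof.
  intros has hst htb.
  apply (derivative_on_pos_lt _ _ _ _ _ dg hst).
  - apply closed_interval_included; assumption.
  - intros c hc; apply g'_pos, (open_interval_included a b s t); assumption.
Qed.

Lemma denominator_pos (s : R) : a < s -> s <= b -> 0 < g s.
Proof. intros has hsb; rewrite <- ga0; apply denominator_lt; lra. Qed.

Lemma increment_eq_derivative_ratio (s t : R) :
  a <= s -> s < t -> t <= b ->
  exists c, open_interval s t c /\ f t - f s = f' c / g' c * (g t - g s).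
Proof.
  intros has hst htb.
  destruct (derivative_on_Cauchy_MVT _ _ _ _ _ s t df dg hst)
    as (c & hc & mean_value).
  - apply closed_interval_included; assumption.
  - exists c; split; [exact hc|].
    assert (0 < g' c) by (apply g'_pos, (open_interval_included a b s t); assumption).
    apply (Rmult_eq_reg_r (g' c)); [|lra].
    rewrite mean_value; field; lra.
Qed.

Lemma derivative_ratio_lt_ratio (s : R) :
  open_interval a b s -> f' s / g' s < f s / g s.
Proof.
  intros [has hsb].
  destruct (increment_eq_derivative_ratio a s) as (c & [hac hcs] & fs_eq); try lra.
  rewrite fa0, ga0, !Rminus_0_r in fs_eq.
  apply (Rlt_div_r _ _ (g s)); [apply denominator_pos; lra|].
  rewrite fs_eq; apply Rmult_lt_compat_r; [apply denominator_pos; lra|].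
  apply ratio'_decr; [split; lra | split; lra | exact hcs].
Qed.

Lemma ratio_strictly_decreasing :
  strictly_decreasing_on (open_interval a b) (fun s => f s / g s).
Proof.
  intros s t [has hsb] [hat htb] hst.
  destruct (increment_eq_derivative_ratio s t) as (c & [hsc hct] & ft_eq); try lra.
  assert (g_s_pos : 0 < g s) by (apply denominator_pos; lra).
  assert (g_lt : g s < g t) by (apply denominator_lt; lra).
  assert (slope_lt : f' c / g' c < f s / g s).
  { apply Rlt_trans with (f' s / g' s).
    - apply ratio'_decr; [split; lra | split; lra | exact hsc].
    - apply derivative_ratio_lt_ratio; split; assumption. }
  assert (fs_eq : f s = f s / g s * g s) by (field; lra).
  apply (Rlt_div_l _ _ (g t)); [lra|].
  apply (Rmult_lt_compat_r (g t - g s)) in slope_lt; lra.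
Qed.

End MonotoneLHopital.

Definition product_quotient (p a q b : R) : R :=
  (p * a + q * b + 2 * (a * b)) / (a + b).

Lemma product_quotient_derivatives (f f' f'' g g' g'' : R) :
  0 < f -> 0 < f' -> 0 < g -> 0 < g' ->
  product_quotient (f'' / f') (f' / f) (g'' / g') (g' / g) =
  ((f'' * g + f' * g') + (f' * g' + f * g'')) / (f' * g + f * g').
Proof.
  intros hf hf' hg hg'.
  assert (0 < f' * g) by (apply Rmult_lt_0_compat; assumption).
  assert (0 < f * g') by (apply Rmult_lt_0_compat; assumption).
  unfold product_quotient; field; repeat split; lra.
Qed.

Lemma product_quotient_sym (p a q b : R) :
  product_quotient p a q b = product_quotient q b p a.
Proof. unfold product_quotient; f_equal; ring. Qed.

Lemma product_quotient_lt_p (p1 p2 a q b : R) :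
  0 < a -> 0 < b -> p2 < p1 ->
  product_quotient p2 a q b < product_quotient p1 a q b.
Proof.
  intros ha hb hp; unfold product_quotient.
  apply Rmult_lt_compat_r; [apply Rinv_0_lt_compat; lra|].
  assert (p2 * a < p1 * a) by (apply Rmult_lt_compat_r; lra).
  lra.
Qed.

Lemma product_quotient_le_a (p a1 a2 q b : R) :
  0 < a2 -> a2 <= a1 -> 0 < b -> q <= p + 2 * b ->
  product_quotient p a2 q b <= product_quotient p a1 q b.
Proof.
  intros ha2 ha hb hpq; unfold product_quotient.
  apply Rminus_le_0.
  replace (_ - _) with
    ((a1 - a2) * (b * (p - q + 2 * b)) * / ((a1 + b) * (a2 + b))) by (field; lra).
  repeat apply Rmult_le_pos; try lra.
  left; apply Rinv_0_lt_compat, Rmult_lt_0_compat; lra.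
Qed.

Lemma product_quotient_strictly_decreasing (D : R -> Prop) (p a q b : R -> R) :
  (forall s, D s -> 0 < p s < a s) -> (forall s, D s -> 0 < q s < b s) ->
  strictly_decreasing_on D p -> strictly_decreasing_on D a ->
  strictly_decreasing_on D q -> strictly_decreasing_on D b ->
  strictly_decreasing_on D (fun s => product_quotient (p s) (a s) (q s) (b s)).
Proof.
  intros hpa hqb p_decr a_decr q_decr b_decr s t hs ht hst.
  pose proof (hpa t ht); pose proof (hqb t ht).
  pose proof (p_decr s t hs ht hst); pose proof (a_decr s t hs ht hst).
  pose proof (q_decr s t hs ht hst); pose proof (b_decr s t hs ht hst).
  apply Rle_lt_trans with (product_quotient (p t) (a s) (q t) (b t)).
  { apply product_quotient_le_a; lra. }
  rewrite (product_quotient_sym (p t)).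
  apply Rle_lt_trans with (product_quotient (q t) (b s) (p t) (a s)).
  { apply product_quotient_le_a; lra. }
  apply Rlt_trans with (product_quotient (q s) (b s) (p t) (a s)).
  { apply product_quotient_lt_p; lra. }
  rewrite product_quotient_sym.
  apply product_quotient_lt_p; lra.
Qed.

Lemma class_M_derivative_ratios (m m' m'' : R -> R) :
  C2_01 m m' m'' -> m 0 = 0 -> m' 0 = 0 ->
  (forall s, 0 < s <= 1 -> 0 < m' s) -> (forall s, 0 < s <= 1 -> 0 < m'' s) ->
  strictly_decreasing_on (open_interval 0 1) (fun s => m'' s / m' s) ->
  (forall s, open_interval 0 1 s -> 0 < m'' s / m' s < m' s / m s) /\
  strictly_decreasing_on (open_interval 0 1) (fun s => m' s / m s).
Proof.
  intros (dm & dm' & _) m0 m'0 m'_pos m''_pos C4.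
  assert (m'_pos_open : forall s, open_interval 0 1 s -> 0 < m' s).
  { intros s [hs0 hs1]; apply m'_pos; lra. }
  split.
  - intros s hs; split.
    + destruct hs; apply Rdiv_lt_0_compat; [apply m''_pos | apply m'_pos]; lra.
    + apply (derivative_ratio_lt_ratio 0 1); assumption.
  - apply (ratio_strictly_decreasing 0 1 m' m'' m m'); assumption.
Qed.

Theorem corollary1 (m1 m2 : R -> R) (hm1 : class_M m1) (hm2 : class_M m2) :
  class_M (fun s => m1 s * m2 s).
Proof.
  destruct hm1 as (f' & f'' & Cf & (f_pos & f0) & (f'_pos & f'0) & f''_pos & f_C4).
  destruct hm2 as (g' & g'' & Cg & (g_pos & g0) & (g'_pos & g'0) & g''_pos & g_C4).
  destruct (class_M_derivative_ratios m1 f' f'') as [f_ratios f_decr]; try assumption.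
  destruct (class_M_derivative_ratios m2 g' g'') as [g_ratios g_decr]; try assumption.
  eexists; eexists; split; [exact (C2_01_mult _ _ _ _ _ _ Cf Cg)|].
  split; [|split; [|split]].
  - split; [intros s hs; apply Rmult_lt_0_compat; auto | rewrite f0; ring].
  - split; [|rewrite f0, f'0; ring].
    intros s hs; apply Rplus_lt_0_compat; apply Rmult_lt_0_compat; auto.
  - intros s hs; repeat apply Rplus_lt_0_compat; apply Rmult_lt_0_compat; auto.
  - eapply strictly_decreasing_on_ext;
      [|exact (product_quotient_strictly_decreasing _ _ _ _ _
                 f_ratios g_ratios f_C4 f_decr g_C4 g_decr)].
    intros s [hs0 hs1]; assert (0 < s <= 1) by lra.
    apply product_quotient_derivatives; auto.
Qed.
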